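(* Let $d\ge 1$ and $n\ge d+1$ be integers and let $G=C_n^d$ be the $d$-th power of the cycle graph $C_n$. Let $K$ be a field, $T=K[s_i,t_i: 1\le i\le n]$, and let $I\subset T$ be the monomial ideal of independent sets of $C_n^d$. Then $$\beta_i(I)=\sum_{k=0}^{\left\lfloor \frac{n}{d+1}\right\rfloor}\frac{n}{n-dk}\binom{n-dk}{k}\binom{k}{i}\quad\text{for } i\ge 0,\qquad\text{and}\qquad \mathrm{proj\,dim}(T/I)=\left\lfloor \frac{n}{d+1}\right\rfloor+1.$$
   Context: $C_n$ is the cycle graph on $\{1,\dots,n\}$, with edges $\{i,i+1\}$ for $1\le i\le n-1$ and $\{n,1\}$; for $n=2$, $C_2$ is understood as the simple graph with the single edge $\{1,2\}$. The $d$-th power $G^d$ of a graph $G$ has the same vertex set as $G$, and two distinct vertices are adjacent in $G^d$ if and only if their distance in $G$ is at most $d$. A set of vertices of a graph is independent if no two of its elements are adjacent (the empty set is independent). The monomial ideal of independent sets of a graph $G$ with vertex set $V(G)$ is the squarefree monomial ideal of $K[s_i,t_i:i\in V(G)]$ generated by the monomials $\prod_{r\in S}s_r\prod_{r\in V(G)\setminus S}t_r$, with $S$ ranging over all independent sets of $G$. $\beta_i(I)$ denotes the $i$-th total Betti number, i.e. the rank of the $i$-th free module in the minimal graded free resolution of $I$ over $T$ (with $\beta_0(I)$ the number of minimal generators of $I$). *)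

(* Defs.v *)
From HB Require Import structures.
From mathcomp Require Import all_boot all_order all_algebra.
From mathcomp Require Import generic_quotient ring_quotient boolp mpoly.
Set Implicit Arguments. Unset Strict Implicit. Unset Printing Implicit Defensive.
Import GRing.Theory.
Local Open Scope ring_scope.

Section Graphs.

Variable T : finType.
Implicit Types (e : rel T) (x y : T).

Definition has_walk e (k : nat) x y : bool :=
  [exists p : k.-tuple T, path e x p && (last x p == y)].

Definition at_dist e (k : nat) x y : bool :=
  has_walk e k x y && [forall j : 'I_k, ~~ has_walk e j x y].

Definition graph_power e (d : nat) : rel T :=
  fun x y => (x != y) && [exists k : 'I_d.+1, at_dist e k x y].

Definition independent e (S : {set T}) : bool :=
  [forall x in S, forall y in S, ~~ e x y].

End Graphs.

(* Vertices are numbered from 0.  Adjacency is a relation, so for [n = 2] the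
   two descriptions of the edge {0, 1} give a single edge; [i != j] only
   matters for [n = 1], where it rules out a loop. *)
Definition cycle_graph (n : nat) : rel 'I_n :=
  fun i j => (i != j) &&
    [|| j == i.+1 :> nat, i == j.+1 :> nat,
        (i == 0%N :> nat) && (j.+1 == n) | (j == 0%N :> nat) && (i.+1 == n)].

Section GeneratedIdeal.

Variables (R : comNzRingType) (J : finType) (P : {pred J}) (g : J -> R).

(* Typed over the regular module so that the quotient below is an [R]-module. *)
Definition gen_ideal : {pred R^o} :=
  fun x => `[< exists c : J -> R, x = \sum_(j | P j) c j * g j >].

Lemma gen_ideal_submod_closed : subsemimod_closed gen_ideal.
Proof.
split; first split.
- by apply/asboolP; exists (fun=> 0); rewrite big1 // => j _; rewrite mul0r.
- move=> x y /asboolP[a ->] /asboolP[b ->]; apply/asboolP.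
  exists (fun j => a j + b j); rewrite -big_split /=.
  by apply: eq_bigr => j _; rewrite mulrDl.
move=> r x /asboolP[a ->]; apply/asboolP; exists (fun j => r * a j).
by rewrite scaler_sumr; apply: eq_bigr => j _; rewrite -mulrA.
Qed.

HB.instance Definition _ :=
  GRing.isSubmodClosed.Build R R^o gen_ideal gen_ideal_submod_closed.

End GeneratedIdeal.

Section QuotientModule.

Variables (R : nzRingType) (V : lmodType R) (S : submodClosed V).

Definition submod_mem : {pred V} := fun x => x \in S.

Lemma submod_mem_zmod_closed : zmod_closed submod_mem.
Proof.
split=> [|x y]; first exact: (rpred0 S).
move=> Sx Sy; apply: (@rpredD _ S) => //.
by rewrite -scaleN1r; apply: (@rpredZ _ _ S).
Qed.

HB.instance Definition _ :=
  GRing.isZmodClosed.Build V submod_mem submod_mem_zmod_closed.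

Definition quotmod : Type := Quotient.quot submod_mem.

HB.instance Definition _ := GRing.Zmodule.on quotmod.
HB.instance Definition _ := Quotient.on quotmod.

Local Open Scope quotient_scope.

Definition quotmod_scale (a : R) (x : quotmod) : quotmod :=
  \pi_quotmod (a *: repr x).

Lemma pi_quotmodZ a x :
  \pi_quotmod (a *: x) = quotmod_scale a (\pi_quotmod x).
Proof.
apply/eqP; rewrite -[_ == _]Quotient.idealrBE -scalerBr.
apply: (@rpredZ _ _ S); apply: (_ : _ \in submod_mem).
by rewrite Quotient.idealrBE reprK.
Qed.

Lemma pi_quotmodD x y :
  \pi_quotmod (x + y) = \pi_quotmod x + \pi_quotmod y.
Proof. exact: Quotient.pi_add. Qed.

Lemma quotmodW x : exists v : V, x = \pi_quotmod v.
Proof. by exists (repr x); rewrite reprK. Qed.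

Lemma quotmod_scaleA a b x :
  quotmod_scale a (quotmod_scale b x) = quotmod_scale (a * b) x.
Proof. by have [v ->] := quotmodW x; rewrite -!pi_quotmodZ scalerA. Qed.

Lemma quotmod_scale1 : left_id 1 quotmod_scale.
Proof. by move=> x; have [v ->] := quotmodW x; rewrite -pi_quotmodZ scale1r. Qed.

Lemma quotmod_scaleDr : right_distributive quotmod_scale +%R.
Proof.
move=> a x y; have [v ->] := quotmodW x; have [w ->] := quotmodW y.
by rewrite -pi_quotmodD -!pi_quotmodZ scalerDr pi_quotmodD.
Qed.

Lemma quotmod_scaleDl x : {morph quotmod_scale^~ x : a b / a + b}.
Proof.
move=> a b; have [v ->] := quotmodW x.
by rewrite -!pi_quotmodZ scalerDl pi_quotmodD.
Qed.

HB.instance Definition _ := GRing.Zmodule_isLmodule.Build R quotmod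
  quotmod_scaleA quotmod_scale1 quotmod_scaleDr quotmod_scaleDl.

End QuotientModule.

Section ProjectiveDimension.

Variable R : nzRingType.

Definition surjective (A B : Type) (f : A -> B) : Prop :=
  forall y, exists x, f x = y.

Definition projective (P : lmodType R) : Prop :=
  forall (M N : lmodType R) (g : {linear M -> N}) (f : {linear P -> N}),
    surjective g -> exists h : {linear P -> M}, forall x, g (h x) = f x.

Record proj_resolution (M : lmodType R) := ProjResolution {
  pr_mod : nat -> lmodType R;
  pr_aug : {linear pr_mod 0 -> M};
  pr_diff : forall i, {linear pr_mod i.+1 -> pr_mod i};
  pr_projective : forall i, projective (pr_mod i);
  pr_aug_surj : surjective pr_aug;
  pr_exact0 : forall x, pr_aug x = 0 <-> exists y, pr_diff 0 y = x;
  pr_exact : forall i x, pr_diff i x = 0 <-> exists y, pr_diff i.+1 y = x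
}.

Definition proj_dim_le (M : lmodType R) (m : nat) : Prop :=
  exists P : proj_resolution M,
    forall i, (m < i)%N -> forall x : pr_mod P i, x = 0.

Definition proj_dim_eq (M : lmodType R) (m : nat) : Prop :=
  proj_dim_le M m /\ forall k, proj_dim_le M k -> (m <= k)%N.

End ProjectiveDimension.

Section Betti.

Variables (K : fieldType) (m : nat).
Local Notation T := {mpoly K[m]}.

(* A graded free resolution ... -> F_1 -> F_0 -> I -> 0 with
   F_i = \bigoplus_j T(- fr_deg i j).  Elements of F_i are row vectors, on which
   maps act by right multiplication by their matrix; the two [_homog] fields
   say that these maps have degree 0. *)
Record graded_free_resolution (I : {pred T}) := GradedFreeResolution {
  fr_rank : nat -> nat;
  fr_deg : forall i, 'I_(fr_rank i) -> int;
  fr_aug : 'cV[T]_(fr_rank 0);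
  fr_diff : forall i, 'M[T]_(fr_rank i.+1, fr_rank i);
  fr_aug_homog : forall j mon,
    mon \in msupp (fr_aug j 0) -> (mdeg mon)%:Z = fr_deg j;
  fr_diff_homog : forall i j k mon,
    mon \in msupp (fr_diff i j k) -> (mdeg mon)%:Z = fr_deg j - fr_deg k;
  fr_aug_image : forall p : T,
    p \in I <-> exists u : 'rV[T]_(fr_rank 0), u *m fr_aug = p%:M;
  fr_exact0 : forall u : 'rV[T]_(fr_rank 0),
    u *m fr_aug = 0 <-> exists v, v *m fr_diff 0 = u;
  fr_exact : forall i (u : 'rV[T]_(fr_rank i.+1)),
    u *m fr_diff i = 0 <-> exists v, v *m fr_diff i.+1 = u
}.

(* F_(i+1) is mapped into the product of the ideal of the variables and F_i. *)
Definition minimal_resolution (I : {pred T}) (F : graded_free_resolution I) :=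
  forall i j k, (fr_diff F i j k)@_0%MM = 0.

(* [b] is the [i]-th total Betti number of [I].  Uniqueness of the minimal
   resolution is not presupposed: one exists, and all have rank [b] at [i]. *)
Definition total_betti (I : {pred T}) (i b : nat) : Prop :=
  (exists F : graded_free_resolution I, minimal_resolution F) /\
  (forall F : graded_free_resolution I, minimal_resolution F -> fr_rank F i = b).

End Betti.

Section IndependenceIdeal.

Variables (K : fieldType) (n : nat) (e : rel 'I_n).

(* In K[s_i, t_i] the variable s_i has index [lshift n i], and t_i has index
   [rshift n i]. *)
Definition var_s (i : 'I_n) : {mpoly K[n + n]} := 'X_(lshift n i).
Definition var_t (i : 'I_n) : {mpoly K[n + n]} := 'X_(rshift n i).

Definition set_monomial (S : {set 'I_n}) : {mpoly K[n + n]} :=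
  (\prod_(r in S) var_s r) * \prod_(r in ~: S) var_t r.

Definition indep_ideal := gen_ideal (independent e) set_monomial.

HB.instance Definition _ := GRing.SubmodClosed.on indep_ideal.

End IndependenceIdeal.

Arguments indep_ideal K [n] e.
Arguments cycle_graph : clear implicits.

(* Main.v *)
From HB Require Import structures.
Require Import Defs.
From mathcomp Require Import all_boot all_order all_algebra ring zify.
From mathcomp Require Import generic_quotient ring_quotient boolp mpoly.
Set Implicit Arguments. Unset Strict Implicit. Unset Printing Implicit Defensive.
Import GRing.Theory.
Local Open Scope ring_scope.

(** Write [D] for the family of independent sets; it is closed under taking
    subsets.  The ideal [I] is generated by the monomials [g_S], [S] in [D], and
    every [S] in [D] spans, together with any subset [A] of it, the cube of all
    sets between [S \ A] and [S].  These cubes are the faces of a cubical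
    complex, and that complex supports a free resolution of [I]: in degree [i]
    there is one generator [e(S, A)] for each pair with [A] a subset of [S], [S]
    in [D] and [|A| = i], and

      [e(S, A) |-> sum over a in A of +- (t_a e(S, A \ a) - s_a e(S \ a, A \ a))].

    Exactness ([chain_exact]) is seen by filtering by [|S|].  On the graded
    pieces only the [t_a]-terms survive, so the piece of [S] is the Koszul
    complex on the variables [t_a], [a] in [S]; an explicit contraction
    ([koszul_homotopy]) shows that it is acyclic in positive degrees.  In degree
    zero its homology is the quotient by the ideal of those [t_a], and what is
    needed there is that a relation [sum_S v_S g_S = 0] forces [v_S] into that
    ideal for every [S] of maximal size: setting [t_a = 0] for all [a] in [S]
    kills all other generators of the relation and fixes the monomial [g_S].

    All entries of the differential are signed variables, so the resolution is
    minimal, and its [i]-th rank is the sum of [binomial(|S|, i)] over [D].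
    That every minimal resolution has these ranks, and that no projective
    resolution of [T/I] is shorter, both follow from comparing resolutions: a
    lift of the identity to another resolution and back is homotopic to the
    identity ([comparison_homotopy]), and modulo the variables the homotopy
    disappears ([minimal_comparison]).

    It remains to count.  A set is independent in the [d]-th power of the cycle
    if and only if its elements are more than [d] apart on the cycle
    ([independent_cycle_power]).  Such a set contains at most one of the vertices
    [0, ..., d], and once that vertex is chosen, or none is, the rest is a sparse
    set in an interval, for which there is a binomial formula
    ([card_sparse_sets]).  This gives [n/(n-dk) binomial(n-dk, k)] sets of size
    [k] for [k] up to [n/(d+1)] and none beyond ([mul_card_indep_sets],
    [card_indep_sets_eq0]). *)

(** * Lifting along linear maps and comparing projective resolutions *)

Section Image.

Variables (R : nzRingType) (A B : lmodType R) (g : {linear A -> B}).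

Definition image_pred : {pred B} := fun y => `[< exists x, g x = y >].

Lemma image_pred_closed : subsemimod_closed image_pred.
Proof.
split; first split.
- by apply/asboolP; exists 0; rewrite linear0.
- move=> x y /asboolP[a <-] /asboolP[b <-]; apply/asboolP.
  by exists (a + b); rewrite linearD.
move=> r x /asboolP[a <-]; apply/asboolP; exists (r *: a).
by rewrite linearZ.
Qed.

HB.instance Definition _ :=
  GRing.isSubmodClosed.Build R B image_pred image_pred_closed.

(** The image has to be a module in its own right: projectivity only gives lifts
    along maps that are surjective onto their codomain. *)
Definition image_mod : Type := {y | image_pred y}.
HB.instance Definition _ := SubType.on image_mod.
HB.instance Definition _ := [Choice of image_mod by <:].
HB.instance Definition _ := [SubChoice_isSubLmodule of image_mod by <:].

Lemma corestrict (C : lmodType R) (f : {linear C -> B}) :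
  (forall x, exists y, g y = f x) ->
  exists f' : {linear C -> image_mod}, forall x, val (f' x) = f x.
Proof.
move=> fg.
have imf x : f x \in image_pred by apply/asboolP.
pose f' x : image_mod := Sub (f x) (imf x).
have linf' : linear f'.
  by move=> a x y; apply: val_inj; rewrite /= linearP.
pose m := GRing.isLinear.Build R C image_mod _ f' linf'.
pose l : {linear C -> image_mod} := HB.pack f' m.
by exists l.
Qed.

Lemma projective_lift (P : lmodType R) (f : {linear P -> B}) :
  projective P -> (forall x, exists y, g y = f x) ->
  exists h : {linear P -> A}, forall x, g (h x) = f x.
Proof.
move=> projP fg.
have [f' f'E] := corestrict fg.
have [|g' g'E] := @corestrict A g; first by move=> x; exists x.
have [|h hE] := projP _ _ g' f'.
  case=> y ygP; have /asboolP[x gx] := ygP.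
  by exists x; apply: val_inj; rewrite g'E.
by exists h => x; rewrite -g'E hE f'E.
Qed.

End Image.

Section Comparison.

Variables (R : nzRingType) (M : lmodType R).
Implicit Types (P Q : proj_resolution M).

Definition pr_cycle P i : pr_mod P i -> Prop :=
  if i is j.+1 then fun x => pr_diff P j x = 0 else fun x => pr_aug P x = 0.

Lemma pr_cycleP P i x : pr_cycle x <-> exists y, pr_diff P i y = x.
Proof. by case: i x => [|i] x; [apply: pr_exact0 | apply: pr_exact]. Qed.

Definition preserves_cycles P Q i (f : pr_mod P i -> pr_mod Q i) :=
  forall x, pr_cycle x -> pr_cycle (f x).

Lemma lift_aug P Q : exists f : {linear pr_mod P 0 -> pr_mod Q 0},
  forall x, pr_aug Q (f x) = pr_aug P x.
Proof.
have [|f fE] := @pr_projective _ _ P 0 _ _ (pr_aug Q) (pr_aug P).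
  exact: pr_aug_surj.
by exists f.
Qed.

Lemma lift_diff P Q i (f : {linear pr_mod P i -> pr_mod Q i}) :
  preserves_cycles f ->
  exists f' : {linear pr_mod P i.+1 -> pr_mod Q i.+1},
    forall x, pr_diff Q i (f' x) = f (pr_diff P i x).
Proof.
move=> fcyc.
have [||f' f'E] := @projective_lift _ _ _ (pr_diff Q i) (pr_mod P i.+1)
  (f \o pr_diff P i).
- exact: pr_projective.
- by move=> x; apply/pr_cycleP; apply: fcyc; apply/pr_cycleP; exists x.
by exists f'.
Qed.

Lemma lift_cycles P Q i (f : {linear pr_mod P i -> pr_mod Q i})
    (f' : {linear pr_mod P i.+1 -> pr_mod Q i.+1}) :
  (forall x, pr_diff Q i (f' x) = f (pr_diff P i x)) -> preserves_cycles f'.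
Proof. by move=> f'E x /= dx; rewrite f'E dx linear0. Qed.

(** The usual inductive step: [g' f' - 1 - h d] has values in the cycles, because
    [d (g' f' - 1) = (g f - 1) d = d h d], so it lifts along the next
    differential. *)
Lemma homotopy_step P Q i (f : {linear pr_mod P i -> pr_mod Q i})
    (g : {linear pr_mod Q i -> pr_mod P i})
    (h : {linear pr_mod P i -> pr_mod P i.+1})
    (f' : {linear pr_mod P i.+1 -> pr_mod Q i.+1})
    (g' : {linear pr_mod Q i.+1 -> pr_mod P i.+1}) :
  (forall x, pr_diff Q i (f' x) = f (pr_diff P i x)) ->
  (forall x, pr_diff P i (g' x) = g (pr_diff Q i x)) ->
  (forall x, pr_cycle x -> g (f x) - x = pr_diff P i (h x)) ->
  exists h' : {linear pr_mod P i.+1 -> pr_mod P i.+2},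
    forall x, g' (f' x) - x = pr_diff P i.+1 (h' x) + h (pr_diff P i x).
Proof.
move=> f'E g'E hE.
have [||h' h'E] := @projective_lift _ _ _ (pr_diff P i.+1) (pr_mod P i.+1)
    (((g' \o f') \- idfun) \- (h \o pr_diff P i)).
- exact: pr_projective.
- move=> x; apply/pr_cycleP => /=.
  rewrite !(linearB (pr_diff P i)) g'E f'E -hE ?subrr //.
  by apply/pr_cycleP; exists x.
by exists h' => x; rewrite h'E /= subrK.
Qed.

(** Restricting the homotopy relation to cycles removes its term [h d], so the
    same statement serves in degree zero and in the induction. *)
Lemma homotopy_on_cycles P Q i :
  exists (f : {linear pr_mod P i -> pr_mod Q i})
         (g : {linear pr_mod Q i -> pr_mod P i})
         (h : {linear pr_mod P i -> pr_mod P i.+1}),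
    [/\ preserves_cycles f, preserves_cycles g &
        forall x, pr_cycle x -> g (f x) - x = pr_diff P i (h x)].
Proof.
elim: i => [|i [f [g [h [fcyc gcyc hE]]]]].
  have [f fE] := lift_aug P Q; have [g gE] := lift_aug Q P.
  have [||h hE] := @projective_lift _ _ _ (pr_diff P 0) (pr_mod P 0)
    ((g \o f) \- idfun).
  - exact: pr_projective.
  - by move=> x; apply/pr_cycleP; rewrite /= linearB /= gE fE subrr.
  by exists f, g, h; split=> [x /=|x /=|x _]; rewrite ?fE ?gE // hE.
have [f' f'E] := lift_diff fcyc; have [g' g'E] := lift_diff gcyc.
have [h' h'E] := homotopy_step f'E g'E hE.
exists f', g', h'.
split; [exact: lift_cycles f'E | exact: lift_cycles g'E |].
by move=> x /= dx; rewrite h'E /= dx linear0 addr0.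
Qed.

(** The two lifts of the identity of [M] compose to a map homotopic to the
    identity.  The form of both error terms matters: each factors through a
    differential of [P], which is what minimality makes vanish modulo the
    variables. *)
Lemma comparison_homotopy P Q i :
  exists (f : {linear pr_mod P i.+1 -> pr_mod Q i.+1})
         (g : {linear pr_mod Q i.+1 -> pr_mod P i.+1})
         (h : {linear pr_mod P i.+1 -> pr_mod P i.+2})
         (h' : {linear pr_mod P i -> pr_mod P i.+1}),
    forall x, g (f x) - x = pr_diff P i.+1 (h x) + h' (pr_diff P i x).
Proof.
have [f [g [h [fcyc gcyc hE]]]] := homotopy_on_cycles P Q i.
have [f' f'E] := lift_diff fcyc; have [g' g'E] := lift_diff gcyc.
have [h' h'E] := homotopy_step f'E g'E hE.
by exists f', g', h', h.
Qed.

End Comparison.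

(** * Projective resolutions of a quotient from free resolutions of an ideal *)

Lemma projective_rV (R : nzRingType) r : projective ('rV[R]_r : lmodType R).
Proof.
move=> M N g f gsurj.
have [x xE] := choice (fun j : 'I_r => gsurj (f (delta_mx 0 j))).
pose h (u : 'rV[R]_r) := \sum_j u 0 j *: x j.
have linh : linear h.
  move=> a u v; rewrite /h scaler_sumr -big_split; apply: eq_bigr => j _ /=.
  by rewrite !mxE scalerDl scalerA.
pose m := GRing.isLinear.Build R 'rV[R]_r M _ h linh.
pose l : {linear 'rV[R]_r -> M} := HB.pack h m.
exists l => u; rewrite {2}[u]row_sum_delta /= /h !linear_sum.
by apply: eq_bigr => j _; rewrite !linearZ /= xE.
Qed.

Section ResolutionOfQuotient.

Variables (K : fieldType) (m : nat).
Local Notation T := {mpoly K[m]}.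
Variables (I : submodClosed T^o) (F : graded_free_resolution I).

(** The resolution of the quotient is the one of [I], shifted by one degree, with
    the ring itself in degree zero and the generators of [I] as the first
    differential. *)
Definition quot_rank i := if i is j.+1 then fr_rank F j else 1%N.

Definition quot_diff i : 'M[T]_(quot_rank i.+1, quot_rank i) :=
  match i with 0 => fr_aug F | j.+1 => fr_diff F j end.

Definition quot_aug (u : 'rV[T]_1) : quotmod I :=
  \pi_(quotmod I)%qT (u 0 0 : T^o).

Lemma quot_aug_linear : linear quot_aug.
Proof.
move=> a u v; rewrite /quot_aug !mxE.
by rewrite (pi_quotmodD I) (pi_quotmodZ I).
Qed.

HB.instance Definition _ :=
  GRing.isLinear.Build T 'rV[T]_1 (quotmod I) _ quot_aug quot_aug_linear.

Lemma quot_aug_surj : surjective quot_aug.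
Proof.
move=> x; have [v ->] := quotmodW x.
by exists (v%:M); rewrite /quot_aug mxE eqxx mulr1n.
Qed.

Lemma quot_exact0 (x : 'rV[T]_1) :
  quot_aug x = 0 <-> exists y, y *m quot_diff 0 = x.
Proof.
have -> : quot_aug x = 0 <-> (x 0 0) \in I.
  have -> : 0 = \pi_(quotmod I)%qT 0.
    have := pi_quotmodZ I 0 0; rewrite scaler0 => ->.
    exact/esym/(scale0r (_ : quotmod I)).
  rewrite /quot_aug -[X in _ <-> is_true X]/(x 0 0 \in submod_mem I).
  by split=> [/eqP|xI]; last apply/eqP; rewrite -Quotient.idealrBE subr0.
rewrite (fr_aug_image F).
by split=> [[u uE]|[y <-]]; [exists u; rewrite [x]mx11_scalar|
   exists y; rewrite [LHS]mx11_scalar].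
Qed.

Definition quot_resolution : proj_resolution (quotmod I).
Proof.
refine (@ProjResolution _ (quotmod I) (fun i => 'rV[T]_(quot_rank i))
  quot_aug (fun i => mulmxr (quot_diff i)) _ _ _ _).
- by move=> i; apply: projective_rV.
- exact: quot_aug_surj.
- exact: quot_exact0.
by case=> [|i] x; [apply: fr_exact0 | apply: fr_exact].
Defined.

End ResolutionOfQuotient.

(** * Minimal resolutions modulo the variables *)

Section Minimality.

Variables (K : fieldType) (m : nat).
Local Notation T := {mpoly K[m]}.
Local Notation const_mx0 := (map_mx (mcoeff 0%MM : T -> K)).
Variable I : submodClosed T^o.
Hypothesis I_const : forall p : T, p \in I -> p@_0%MM = 0.
Implicit Types F G : graded_free_resolution I.

(** In the first step of the resolution of the quotient this is not minimality of
    [F], but properness of [I]: the entries of the augmentation lie in [I]. *)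
Lemma const_mx0_quot_diff F i :
  minimal_resolution F -> const_mx0 (quot_diff F i) = 0.
Proof.
move=> Fmin; apply/matrixP => j k; rewrite !mxE.
case: i j k => [|i] j k /=; last exact: Fmin.
apply/I_const/(fr_aug_image F); exists (delta_mx 0 j).
by rewrite -rowE; apply/matrixP => x y; rewrite !ord1 !mxE eqxx.
Qed.

(** Both terms of the homotopy contain a factor [quot_diff], so they vanish
    modulo the variables. *)
Lemma minimal_comparison F (Q : proj_resolution (quotmod I)) i :
  minimal_resolution F ->
  exists (f : {linear 'rV[T]_(fr_rank F i) -> pr_mod Q i.+1})
         (g : {linear pr_mod Q i.+1 -> 'rV[T]_(fr_rank F i)}),
    forall x, const_mx0 (g (f x)) = const_mx0 x.
Proof.
move=> Fmin.
have [f [g [h [h' E]]]] := comparison_homotopy (quot_resolution F) Q i.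
exists f, g => x; apply/eqP; rewrite -subr_eq0 -map_mxB; apply/eqP.
have -> : g (f x) - x = h x *m quot_diff F i.+1 +
   x *m quot_diff F i *m lin1_mx h' by rewrite mul_rV_lin1 -E.
by rewrite map_mxD !map_mxM !(const_mx0_quot_diff _ Fmin)
           !(mulmx0, mul0mx) addr0.
Qed.

(** Modulo the variables the comparison maps are matrices over the field [K] whose
    product is an identity matrix. *)
Lemma minimal_rank_le F G i :
  minimal_resolution F -> (fr_rank F i <= fr_rank G i)%N.
Proof.
move=> Fmin.
have [f [g E]] := @minimal_comparison F (quot_resolution G) i Fmin.
apply: leq_trans (rank_leq_col (const_mx0 (lin1_mx f : 'M_(_, fr_rank G i)))).
apply: (@mulmx1_min_rank _ _ _ _ _ 1%:M (const_mx0 (lin1_mx g))).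
rewrite mul1mx -map_mxM; apply/row_matrixP => j; rewrite -map_row row_mul.
rewrite mul_rV_lin1 rowE mul_rV_lin1 E.
by rewrite rowE mulmx1 map_delta_mx.
Qed.

Lemma minimal_total_betti F i :
  minimal_resolution F -> total_betti I i (fr_rank F i).
Proof.
move=> Fmin; split=> [|G Gmin]; first by exists F.
by apply/eqP; rewrite eqn_leq !minimal_rank_le.
Qed.

(** If a projective resolution vanished in degree [q.+1], the identity of [F] in
    degree [q] would factor through zero modulo the variables. *)
Lemma minimal_proj_dim F q :
  minimal_resolution F -> (fr_rank F q > 0)%N ->
  (forall i, (q < i)%N -> fr_rank F i = 0%N) ->
  proj_dim_eq (quotmod I) q.+1.
Proof.
move=> Fmin Fq F0; split=> [|k [Q Q0]].
  exists (quot_resolution F) => -[//|i] /F0 ri x.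
  by apply/rowP => j; have : (j < 0)%N by rewrite -ri ltn_ord.
rewrite leqNgt; apply/negP => kq.
have [f [g E]] := minimal_comparison Q q Fmin.
have := E (delta_mx 0 (Ordinal Fq)); rewrite [f _](Q0 _ kq) linear0.
move/rowP/(_ (Ordinal Fq)); rewrite !mxE mcoeff0 !eqxx mcoeff1 eqxx.
by move/esym/eqP; rewrite oner_eq0.
Qed.

End Minimality.

(** * Killing and dividing by variables *)

Section KillVariables.

Variables (K : fieldType) (N : nat).
Local Notation T := {mpoly K[N]}.
Implicit Types (B C : {set 'I_N}) (p q : T).

Definition kill B p : T := p \mPo [tuple (if i \in B then 0 else 'X_i) | i < N].

HB.instance Definition _ B := GRing.RMorphism.copy (kill B)
  (comp_mpoly [tuple (if i \in B then 0 else 'X_i) | i < N]).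

Lemma killXU B i : kill B 'X_i = if i \in B then 0 else 'X_i.
Proof. by rewrite /kill comp_mpolyXU -tnth_nth tnth_mktuple. Qed.

Lemma killX B m :
  kill B 'X_[m] = if [forall i in B, m i == 0%N] then 'X_[m] else 0.
Proof.
rewrite /kill comp_mpolyX; case: forall_inP => [mB|/forall_inP].
  rewrite mpolyXE_id; apply: eq_bigr => i _; rewrite tnth_mktuple.
  by case: ifP => // /mB/eqP->.
rewrite negb_forall_in => /exists_inP[i iB mi].
by rewrite (bigD1 i) //= tnth_mktuple iB expr0n (negPf mi) mul0r.
Qed.

Lemma kill_scale B (c : K) p : kill B (c *: p) = c *: kill B p.
Proof. exact: comp_mpolyZ. Qed.

Lemma kill_set0 p : kill set0 p = p.
Proof.
rewrite -[RHS]comp_mpoly_id /kill; congr (_ \mPo _); apply: eq_from_tnth => i.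
by rewrite !tnth_mktuple inE.
Qed.

Lemma kill_kill B C p : kill B (kill C p) = kill (B :|: C) p.
Proof.
elim/mpolyind: p => [|c m p _ _ IH]; first by rewrite !rmorph0.
rewrite !rmorphD /= IH !kill_scale !killX; congr (_ *: _ + _).
have [mC|mC] := boolP [forall i in C, m i == 0%N].
  rewrite killX; congr (if _ then _ else _).
  apply/forall_inP/forall_inP => [mB i|mBC i iB].
    by rewrite inE => /orP[/mB|/(forall_inP mC)].
  by apply: mBC; rewrite inE iB.
rewrite rmorph0; case: forall_inP => // mBC.
by case/forall_inP: mC => i iC; apply: mBC; rewrite inE iC orbT.
Qed.

(** It suffices to look at monomials: killing ['X_i] fixes those free of ['X_i] and
    annihilates the multiples of ['X_i]. *)
Lemma dvdX_sub_kill i p : exists q, 'X_i * q = p - kill [set i] p.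
Proof.
elim/mpolyind: p => [|c m p _ _ [q Eq]].
  by exists 0; rewrite mulr0 rmorph0 subr0.
have [q' Eq'] : exists q', 'X_i * q' = 'X_[m] - kill [set i] 'X_[m].
  rewrite killX; case: forall_inP => [_|mi].
    by exists 0; rewrite mulr0 subrr.
  exists 'X_[m - U_(i)]; rewrite subr0 -mpolyXD addmC submK //.
  apply/mnm_lepP => j; rewrite mnm1E; case: eqP => // <-; rewrite lt0n.
  by apply: contra_notN mi => /eqP mi j' /set1P ->; apply/eqP.
exists (c *: q' + q); rewrite rmorphD /= kill_scale mulrDr -scalerAr Eq Eq'.
by rewrite scalerBr opprD addrACA.
Qed.

(** The part of [p] divisible by ['X_i], divided by ['X_i].  The linearity and
    commutation properties below all come from the uniqueness of this quotient in
    an integral domain. *)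
Definition divX i p : T := sval (cid (dvdX_sub_kill i p)).

Lemma mulX_divX i p : 'X_i * divX i p = p - kill [set i] p.
Proof. exact: (svalP (cid (dvdX_sub_kill i p))). Qed.

Lemma mpolyX_neq0 (m : 'X_{1..N}) : 'X_[m] != 0 :> T.
Proof. by rewrite -msupp_eq0 msuppX. Qed.

Lemma divX_uniq i p q : 'X_i * q = p - kill [set i] p -> divX i p = q.
Proof.
by move=> E; apply: (mulfI (mpolyX_neq0 U_(i))); rewrite mulX_divX E.
Qed.

Lemma divX_is_additive i : additive (divX i).
Proof.
move=> p q; apply: divX_uniq.
by rewrite mulrBr !mulX_divX rmorphB /= !opprD !opprK addrACA.
Qed.

HB.instance Definition _ i := GRing.isAdditive.Build T T (divX i)
  (divX_is_additive i).

Lemma divX_mulX i p : divX i ('X_i * p) = p.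
Proof. by apply: divX_uniq; rewrite rmorphM /= killXU set11 mul0r subr0. Qed.

Lemma divX_mulX_neq i j p : i != j -> divX i ('X_j * p) = 'X_j * divX i p.
Proof.
move=> ij; apply: divX_uniq.
rewrite rmorphM /= killXU inE eq_sym (negPf ij) mulrCA mulX_divX.
by rewrite mulrBr.
Qed.

End KillVariables.

(** * A contraction of the Koszul complex on the variables t *)

Section Koszul.

Variables (K : fieldType) (n : nat).
Local Notation T := {mpoly K[n + n]}.
Implicit Types (S A : {set 'I_n}) (a b : 'I_n) (p : T).

Local Notation s_ := (@var_s K n).
Local Notation t_ := (@var_t K n).

Definition kill_t S : T -> T := kill (@rshift n n @: S).

HB.instance Definition _ S := GRing.RMorphism.on (kill_t S).

Lemma kill_t_t S a : kill_t S (t_ a) = if a \in S then 0 else t_ a.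
Proof. by rewrite /kill_t killXU (mem_imset _ _ (@rshift_inj n n)). Qed.

Lemma kill_t_s S a : kill_t S (s_ a) = s_ a.
Proof.
rewrite /kill_t killXU; case: imsetP => // -[b _ /eqP].
by rewrite eq_lrshift.
Qed.

Definition below S (k : nat) : {set 'I_n} := [set b in S | (b < k)%N].

(** The monomials that are divisible by [t_a] but by no earlier [t_b], [b] in [S],
    divided by [t_a]: every monomial involving some [t_b], [b] in [S], is thus
    attributed to its first such variable. *)
Definition rho S a p : T := divX (rshift n a) (kill_t (below S a) p).

Lemma rho_is_additive S a : additive (rho S a).
Proof. by move=> p q; rewrite /rho !rmorphB raddfB. Qed.

HB.instance Definition _ S a := GRing.isAdditive.Build T T (rho S a)
  (rho_is_additive S a).

Lemma rhoMsign S a k p : rho S a ((-1) ^+ k * p) = (-1) ^+ k * rho S a p.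
Proof. exact: raddfMsign. Qed.

Lemma rho_t_lt S a b p : b \in S -> (b < a)%N -> rho S a (t_ b * p) = 0.
Proof.
by move=> bS ba; rewrite /rho rmorphM /= kill_t_t inE bS ba mul0r raddf0.
Qed.

Lemma rho_t_gt S a b p : (a < b)%N -> rho S a (t_ b * p) = t_ b * rho S a p.
Proof.
move=> ab; rewrite /rho rmorphM /= kill_t_t inE ltnNge (ltnW ab) andbF.
by rewrite divX_mulX_neq // (inj_eq (@rshift_inj n n)) neq_ltn ab.
Qed.

Lemma rho_t S a p : rho S a (t_ a * p) = kill_t (below S a) p.
Proof.
by rewrite /rho rmorphM /= kill_t_t inE ltnn andbF divX_mulX.
Qed.

(** Sorting the monomials of [p] by their first variable [t_b] with [b] in [S] and
    [b < k]. *)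
Lemma kill_below_sum S k p :
  \sum_(b in S | (b < k)%N) t_ b * rho S b p + kill_t (below S k) p = p.
Proof.
elim: k => [|k IH].
  rewrite big_pred0 => [|b]; last by rewrite ltn0 andbF.
  have -> : below S 0 = set0 by apply/setP => b; rewrite !inE ltn0 andbF.
  by rewrite /kill_t imset0 kill_set0 add0r.
(* The sum gains a term only if [k] is a vertex of [S]. *)
have [kS|kS] := boolP [exists b in S, b == k :> nat]; last first.
  have E b : (b \in S) && (b < k.+1)%N = (b \in S) && (b < k)%N.
    rewrite ltnS leq_eqVlt; case bS : (b \in S) => //=.
    by rewrite (negPf (exists_inPn kS b bS)).
  have -> : below S k.+1 = below S k by apply/setP => b; rewrite !inE E.
  by under eq_bigl do rewrite E.
case/exists_inP: kS => b bS /eqP bk.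
rewrite (bigD1 b) ?bS ?bk ?leqnn //.
have E c : (c \in S) && (c < k.+1)%N && (c != b) = (c \in S) && (c < k)%N.
  rewrite -val_eqE /= bk ltnS ltn_neqAle -andbA; congr (_ && _).
  by rewrite andbC.
rewrite (eq_bigl _ _ E) -[RHS]IH [X in _ = X]addrC addrAC; congr (_ + _).
rewrite /rho mulX_divX bk /kill_t kill_kill.
have -> : [set rshift n b] :|: @rshift n n @: below S k =
    @rshift n n @: below S k.+1.
  rewrite -imset_set1 -imsetU; suff -> : below S k.+1 = b |: below S k by [].
  apply/setP => c; rewrite !inE -val_eqE /= bk ltnS [in LHS]leq_eqVlt.
  have [->|] := eqVneq c b; first by rewrite bS bk eqxx.
  by rewrite -val_eqE /= bk => /negPf ->.
by rewrite subrK.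
Qed.

Lemma below_set0 k : below set0 k = set0.
Proof. by apply/setP => b; rewrite !inE. Qed.

Implicit Types w : {set 'I_n} -> T.

(** The Koszul differential on the variables [t_a], [a] in [S], in terms of
    coefficients: [w A] is the coefficient of the basis element of [A]. *)
Definition koszul S w A : T :=
  \sum_(a in S :\: A) (-1) ^+ #|below A a| * (t_ a * w (a |: A)).

(** The contraction adds to a term, monomial times basis element of [A], the
    smallest index [a] in [S] that is in [A] or whose [t_a] divides the monomial,
    provided it comes from the monomial.  Read on coefficients: only the smallest
    element of [A] can have been added, so the sum has one term, or none if [A]
    is empty. *)
Definition koszul_hty S w A : T :=
  if A \subset S then
    \sum_(a in A | [forall b in A, (a <= b)%N]) rho S a (w (A :\ a))
  else 0.

Lemma koszul_hty_min S w A a : A \subset S -> a \in A ->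
  (forall b, b \in A -> (a <= b)%N) -> koszul_hty S w A = rho S a (w (A :\ a)).
Proof.
move=> AS aA amin; rewrite /koszul_hty AS (big_pred1 a) // => b /=.
apply/andP/eqP => [[bA /forall_inP bmin]|->]; last first.
  by split=> //; apply/forall_inP.
by apply/val_inj/eqP; rewrite eqn_leq bmin // amin.
Qed.

(** In degree zero the contraction recovers the part lying in the ideal of the
    variables [t_a], [a] in [S]. *)
Lemma koszul_hty0 S w :
  koszul S (koszul_hty S w) set0 = w set0 - kill_t S (w set0).
Proof.
rewrite /koszul setD0 -[X in _ = X - _](kill_below_sum S n).
have -> : below S n = S by apply/setP => b; rewrite inE ltn_ord andbT.
rewrite addrK; apply: eq_big => [b|b bS]; first by rewrite ltn_ord andbT.
rewrite below_set0 cards0 expr0 mul1r setU0.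
rewrite (@koszul_hty_min S w [set b] b) ?set11 ?sub1set ?setDv //.
by move=> c /set1P ->.
Qed.

(** With [a] the minimum of [A]: in the first term, adding [b < a] makes [b] the
    new minimum and yields [t_b * rho S b (w A)]; in the second, adding back [a]
    yields [w A] with the [t_b], [b < a] in [S], killed.  By [kill_below_sum] these
    make up [w A].  The terms with [b > a] occur in both with opposite signs. *)
Lemma koszul_homotopy S w A : A \subset S -> A != set0 ->
  koszul S (koszul_hty S w) A + koszul_hty S (koszul S w) A = w A.
Proof.
move=> AS /set0Pn[a1 a1A].
have [a aA amin] : exists2 a, a \in A & forall b, b \in A -> (a <= b)%N.
  by case: (@arg_minnP _ a1 (mem A) val a1A) => a aA amin; exists a.
have aS := subsetP AS a aA.
have ltA b : b \in S :\: A -> ~~ (b < a)%N -> (a < b)%N.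
  rewrite inE => /andP[bA _]; rewrite -leqNgt leq_eqVlt.
  case/orP=> [/eqP/val_inj|//].
  by move=> ab; rewrite -ab aA in bA.
have lt_notin b : (b < a)%N -> b \notin A.
  by move=> ba; apply/negP => /amin; rewrite leqNgt ba.
rewrite (@koszul_hty_min _ (koszul S w) A a) // /koszul.
(* The vertices [b < a] give the first half of [kill_below_sum]. *)
rewrite (bigID (fun b : 'I_n => (b < a)%N)) /=.
have -> : \sum_(b in S :\: A | (b < a)%N)
     (-1) ^+ #|below A b| * (t_ b * koszul_hty S w (b |: A)) =
   \sum_(b in S | (b < a)%N) t_ b * rho S b (w A).
  apply: eq_big => [b|b /andP[bSA ba]].
    rewrite inE; case: ltnP => [/lt_notin ->|]; by rewrite ?andbF.
  have -> : below A b = set0.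
    apply/setP => c; rewrite !inE; apply/negP => /andP[/amin ac cb].
    by move: (leq_ltn_trans ac (ltn_trans cb ba)); rewrite ltnn.
  rewrite cards0 expr0 mul1r.
  rewrite (@koszul_hty_min _ _ _ b) ?setU11 ?setU1K ?lt_notin //.
    by rewrite subUset sub1set AS; move: bSA; rewrite inE => /andP[_ ->].
  by move=> c /setU1P[->//|/amin]; apply/leq_trans/ltnW.
(* The index [a] itself gives the second half. *)
rewrite [X in rho S a X](bigD1 a) ?inE ?aS ?eqxx //= raddfD /=.
have -> : below (A :\ a) a = set0.
  apply/setP => c; rewrite !inE; apply/negP => /andP[/andP[_ /amin]].
  by rewrite leqNgt => /negPf ->.
rewrite cards0 expr0 mul1r setD1K // rho_t raddf_sum /=.
(* What is left are the terms with [b > a], from either side. *)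
set X := (X in X + _ + _); set Y := (Y in X + Y + _).
set Z := (Z in _ + (_ + Z)).
suff -> : Y = - Z by rewrite addrACA addNr addr0; exact: kill_below_sum.
rewrite /Z (bigID (fun b : 'I_n => (b < a)%N)) /= big1 ?add0r => [|b]; last first.
  case/andP => /andP[bSA ba] blta; rewrite rhoMsign rho_t_lt ?mulr0 //.
  by move: bSA; rewrite inE => /andP[].
rewrite -sumrN; apply: eq_big => [b|b /andP[bSA nba]].
  rewrite !inE; case: (eqVneq b a) => [->|ba] /=; first by rewrite aA andbF.
  by rewrite andbT.
have ab := ltA b bSA nba; have neq_ab : a != b by rewrite -val_eqE neq_ltn ab.
have bA : b \notin A by move: bSA; rewrite inE => /andP[].
have -> : below A b = a |: below (A :\ a) b.
  by apply/setP => c; rewrite !inE; case: (eqVneq c a) => [->|//]; rewrite aA ab.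
rewrite cardsU1 !inE eqxx add1n exprS mulN1r mulNr rhoMsign rho_t_gt //.
congr (- (_ * (_ * _))).
have -> : b |: A :\ a = (b |: A) :\ a.
  apply/setP => c; rewrite !inE; case: (eqVneq c a) => [->|//].
  by rewrite (negPf neq_ab).
apply: koszul_hty_min; rewrite ?inE ?aA ?orbT //.
  by rewrite subUset sub1set AS; move: bSA; rewrite inE => /andP[_ ->].
by move=> c /setU1P[->|/amin //]; apply: ltnW.
Qed.

End Koszul.

(** * The cubical complex of a family of vertex sets *)

Section CubicalComplex.

Variables (K : fieldType) (n : nat).
Local Notation T := {mpoly K[n + n]}.
Implicit Types (S A : {set 'I_n}) (a b : 'I_n).

Local Notation s_ := (@var_s K n).
Local Notation t_ := (@var_t K n).
Local Notation chain := ({set 'I_n} -> {set 'I_n} -> T).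
Implicit Types v w : chain.

(** The facets of the cube of [(S, A)] in direction [a] are those of [(S, A \ a)]
    and [(S \ a, A \ a)], with coefficients [t_a] and [- s_a].  In terms of the
    smaller face the two cases are told apart by whether it contains [a]. *)
Definition face_coef S a : T := if a \in S then t_ a else - s_ a.

(** Row vectors are written as functions of the face, so the value at [(S, A)]
    collects the faces having [(S, A)] as a facet.  Sums range over all pairs of
    sets; being a chain of the complex is a support condition, [chain_on]. *)
Definition boundary v : chain := fun S A =>
  \sum_(a | a \notin A)
     (-1) ^+ #|below A a| * (face_coef S a * v (a |: S) (a |: A)).

Definition augment v : T := \sum_S v S set0 * set_monomial K S.

Lemma boundaryB v w S A :
  boundary (fun S A => v S A - w S A) S A = boundary v S A - boundary w S A.
Proof.
rewrite /boundary -sumrB; apply: eq_bigr => a _.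
by rewrite !mulrBr.
Qed.

Lemma boundaryD v w S A :
  boundary (fun S A => v S A + w S A) S A = boundary v S A + boundary w S A.
Proof.
rewrite /boundary -big_split; apply: eq_bigr => a _.
by rewrite !mulrDr.
Qed.

Lemma sum_antisym (V : zmodType) (P : pred 'I_n) (f : 'I_n -> 'I_n -> V) :
  (forall a b, P a -> P b -> (a < b)%N -> f a b = - f b a) ->
  \sum_(a | P a) \sum_(b | P b && (b != a)) f a b = 0.
Proof.
move=> fN.
have E a : P a -> \sum_(b | P b && (b != a)) f a b =
   \sum_(b | P b && (a < b)%N) f a b + \sum_(b | P b && (b < a)%N) f a b.
  move=> _; rewrite (bigID (fun b : 'I_n => (a < b)%N)) /=; congr (_ + _);
    apply: eq_bigl => b; rewrite -andbA -val_eqE; case: ltngtP => //=;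
    by rewrite andbT.
rewrite (eq_bigr _ E) big_split /=.
rewrite [X in _ + X](exchange_big_dep P) => [|a b _ /andP[]//] /=.
rewrite -big_split big1 //= => a Pa.
have -> : \sum_(b | P b && (P a && (a < b)%N)) f b a =
          \sum_(b | P b && (a < b)%N) f b a.
  by apply: eq_bigl => b; rewrite Pa.
by rewrite -big_split big1 // => b /andP[Pb ab]; rewrite /= fN // addNr.
Qed.

Lemma card_below_setU1 A a b : a \notin A ->
  #|below (a |: A) b| = ((a < b) + #|below A b|)%N.
Proof.
move=> aA; case: (ltnP a b) => ab.
  have -> : below (a |: A) b = a |: below A b.
    by apply/setP => c; rewrite !inE; case: (eqVneq c a) => [->|//]; rewrite ab.
  by rewrite cardsU1 inE (negPf aA).
suff -> : below (a |: A) b = below A b by [].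
apply/setP => c; rewrite !inE.
by case: (eqVneq c a) => [->|//]; rewrite ltnNge ab /= andbF.
Qed.

(** The terms in which [a] and [b] are added in either order cancel: the
    coefficients do not depend on the order, and the sign changes because [a] is
    counted below [b] or [b] below [a], but not both. *)
Lemma boundary_boundary v S A : boundary (boundary v) S A = 0.
Proof.
pose f a b : T := (-1) ^+ #|below A a| * (face_coef S a *
  ((-1) ^+ #|below (a |: A) b| * (face_coef (a |: S) b *
     v (b |: (a |: S)) (b |: (a |: A))))).
transitivity (\sum_(a | a \notin A) \sum_(b | (b \notin A) && (b != a)) f a b).
  apply: eq_bigr => a aA; rewrite !mulr_sumr; apply: eq_bigl => b.
  by rewrite in_setU1 negb_or andbC.
apply: sum_antisym => a b aA bA ab.
rewrite /f (card_below_setU1 _ aA) (card_below_setU1 _ bA) ab ltnNge (ltnW ab).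
have -> : face_coef (a |: S) b = face_coef S b.
  by rewrite /face_coef in_setU1 -val_eqE gtn_eqF.
have -> : face_coef (b |: S) a = face_coef S a.
  by rewrite /face_coef in_setU1 -val_eqE ltn_eqF.
rewrite (setUCA [set b] [set a] S) (setUCA [set b] [set a] A).
rewrite add1n add0n exprS.
move: (_ ^+ _) (_ ^+ _) (face_coef _ _) (face_coef _ _) (v _ _) => x y z t u.
by ring.
Qed.

(** The linear syzygies that generate all relations between the generators. *)
Lemma set_monomial_exchange S a :
  a \notin S -> t_ a * set_monomial K (a |: S) = s_ a * set_monomial K S.
Proof.
move=> aS; rewrite /set_monomial (big_setU1 _ aS) /=.
have aSC : a \in ~: S by rewrite inE.
rewrite [in RHS](big_setD1 _ aSC) /=.
have -> : (~: S) :\ a = ~: (a |: S) by apply/setP => c; rewrite !inE negb_or.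
by rewrite -!mulrA mulrCA; congr (_ * _); rewrite mulrCA.
Qed.

(** For each [a] the sets with and without [a] are paired, and each pair
    contributes a multiple of the syzygy [set_monomial_exchange]. *)
Lemma augment_boundary v : augment (boundary v) = 0.
Proof.
rewrite /augment /boundary.
under eq_bigr do rewrite mulr_suml.
rewrite exchange_big big1 // => a _ /=.
rewrite (bigID (fun S : {set 'I_n} => a \in S)) /=.
rewrite (reindex_onto (fun S => a |: S) (fun S => S :\ a)) /=; last first.
  by move=> S; apply: setD1K.
have E S : (a \in a |: S) && ((a |: S) :\ a == S) = (a \notin S).
  rewrite setU11 /=; apply/eqP/idP => [<-|/setU1K //].
  by rewrite setD11.
rewrite (eq_bigl _ _ E) -big_split big1 // => S aS.
rewrite setUA setUid /face_coef setU11 (negPf aS).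
have EX := set_monomial_exchange aS.
transitivity ((-1) ^+ #|below (set0 : {set 'I_n}) a| * v (a |: S) (a |: set0) *
  (t_ a * set_monomial K (a |: S) - s_ a * set_monomial K S)).
  by rewrite /=; ring.
by rewrite EX subrr mulr0.
Qed.

End CubicalComplex.

(** * Exactness of the cubical complex *)

Section Exactness.

Variables (K : fieldType) (n : nat) (D : {pred {set 'I_n}}).
Hypothesis D_down :
  forall S S' : {set 'I_n}, S \subset S' -> S' \in D -> S \in D.
Local Notation T := {mpoly K[n + n]}.
Implicit Types (S A : {set 'I_n}) (a b : 'I_n) (i k : nat).

Local Notation chain := ({set 'I_n} -> {set 'I_n} -> T).
Implicit Types v w : chain.

(** The monomial of [S'] involves [t_r] exactly for the [r] outside [S']. *)
Lemma kill_t_set_monomial S S' :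
  kill_t S (set_monomial K S') = if S \subset S' then set_monomial K S' else 0.
Proof.
rewrite /set_monomial rmorphM !rmorph_prod /=.
have -> : \prod_(r in S') kill_t S (var_s K r) = \prod_(r in S') var_s K r.
  by apply: eq_bigr => r _; rewrite kill_t_s.
case: ifPn => [SS'|/subsetPn[r rS rS']].
  congr (_ * _); apply: eq_bigr => r; rewrite inE kill_t_t => rS'.
  by rewrite (contraNF (subsetP SS' r) rS').
have rS'C : r \in ~: S' by rewrite inE.
by rewrite mulrC (bigD1 r rS'C) /= kill_t_t rS !mul0r.
Qed.

Lemma set_monomial_neq0 S : set_monomial K S != 0.
Proof.
rewrite mulf_neq0 // prodf_seq_neq0; apply/allP => r _;
  by rewrite mpolyX_neq0 implybT.
Qed.

Definition chain_on i v :=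
  forall S A, v S A != 0 -> [&& S \in D, A \subset S & #|A| == i].

Lemma chain_on0 i v S A :
  chain_on i v -> ~~ [&& S \in D, A \subset S & #|A| == i] -> v S A = 0.
Proof. by move=> vi; apply: contraNeq => /vi. Qed.

Lemma chain_on_boundary i v : chain_on i.+1 v -> chain_on i (boundary v).
Proof.
move=> vi S A; apply: contraNT => SA; apply/eqP/big1 => a aA.
rewrite [v _ _](chain_on0 vi) ?mulr0 //; apply: contra SA => /and3P[DS sub].
rewrite cardsU1 aA add1n eqSS => ->.
rewrite (D_down _ DS) ?subsetU1 // andbT /=; apply/subsetP => b bA.
have := subsetP sub b; rewrite !inE bA orbT => /(_ isT)/predU1P[E|//].
by rewrite -E bA in aA.
Qed.

(** Setting [t_a = 0] for [a] in [S] kills the monomials of all sets not containing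
    [S], and the sets properly containing [S] carry no coefficient. *)
Lemma top_killed k v S :
  (forall S A, (k < #|S|)%N -> v S A = 0) -> augment v = 0 -> #|S| = k ->
  kill_t S (v S set0) = 0.
Proof.
move=> vk av Sk; apply: (mulIf (set_monomial_neq0 S)); rewrite mul0r.
rewrite -[RHS](rmorph0 (kill_t S)) -av /augment rmorph_sum (bigD1 S) //=.
rewrite rmorphM /= kill_t_set_monomial subxx big1 ?addr0 // => S' S'S.
rewrite rmorphM /= kill_t_set_monomial.
case: ifP => [SS'|]; last by rewrite mulr0.
rewrite vk ?rmorph0 ?mul0r // -Sk proper_card // properEneq SS'.
by rewrite eq_sym S'S.
Qed.

(** On the largest sets the [s_a]-terms come from larger sets, where the chain
    vanishes; so the graded pieces of the filtration by size are Koszul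
    complexes. *)
Lemma boundary_top k w S A :
  (forall S A, (k < #|S|)%N -> w S A = 0) -> #|S| = k ->
  boundary w S A = koszul S (w S) A.
Proof.
move=> wk Sk; rewrite /boundary (bigID (mem S)) /=.
rewrite [X in _ + X]big1 ?addr0 => [|a /andP[aA aS]]; last first.
  by rewrite wk ?mulr0 // cardsU1 aS Sk.
apply: eq_big => [a|a /andP[aA aS]]; first by rewrite inE.
by rewrite /face_coef aS (setUidPr _) ?sub1set.
Qed.

Definition top_fill k v : chain := fun S A =>
  if #|S| == k then koszul_hty S (v S) A else 0.

Lemma top_fill_on i k v : chain_on i v -> chain_on i.+1 (top_fill k v).
Proof.
move=> vi S A; rewrite /top_fill /koszul_hty.
case: ifP => _; last by rewrite eqxx.
case: ifP => AS; last by rewrite eqxx.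
apply: contraNT => SA; apply/eqP/big1 => a /andP[aA _].
rewrite [v _ _](chain_on0 vi) ?raddf0 //; apply: contra SA => /and3P[-> _].
by rewrite (cardsD1 a A) aA add1n eqSS => ->.
Qed.

(** The contraction of the Koszul complex fills a cycle in its top graded piece,
    so subtracting the boundary of the filling lowers the size of the support. *)
Lemma boundary_top_fill i k v S A :
  chain_on i v -> (forall S A, boundary v S A = 0) -> augment v = 0 ->
  (forall S A, (k < #|S|)%N -> v S A = 0) -> (k <= #|S|)%N ->
  boundary (top_fill k v) S A = v S A.
Proof.
move=> vi bv av vk; rewrite leq_eqVlt => /orP[/eqP/esym Sk|kS]; last first.
  rewrite vk // [LHS]big1 // => a _; rewrite /top_fill gtn_eqF ?mulr0 //.
  by apply: leq_trans kS _; rewrite subset_leq_card // subsetU1.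
have [AS|AS] := boolP (A \subset S); last first.
  have fi := chain_on_boundary (@top_fill_on _ k _ vi).
  by rewrite (chain_on0 vi) ?(chain_on0 fi) // (negPf AS) andbF.
rewrite (@boundary_top k) //; last first.
  by move=> S' A' kS'; rewrite /top_fill gtn_eqF.
have -> : koszul S (top_fill k v S) A = koszul S (koszul_hty S (v S)) A.
  by apply: eq_bigr => a _; rewrite /top_fill Sk eqxx.
have [->|A0] := eqVneq A set0.
  by rewrite koszul_hty0 (top_killed vk av Sk) subr0.
have hty0 : koszul_hty S (koszul S (v S)) A = 0.
  rewrite /koszul_hty AS big1 // => a _.
  by rewrite -(boundary_top _ vk Sk) bv raddf0.
by rewrite -[RHS](koszul_homotopy (v S) AS A0) hty0 addr0.
Qed.

(** One statement covers all degrees: for [i] positive a chain has no coefficient at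
    [A = set0], so its augmentation vanishes, and for [i = 0] its boundary
    vanishes. *)
Lemma chain_exact i v :
  chain_on i v -> (forall S A, boundary v S A = 0) -> augment v = 0 ->
  exists2 w, chain_on i.+1 w & forall S A, boundary w S A = v S A.
Proof.
have : forall S A, (n.+1 <= #|S|)%N -> v S A = 0.
  by move=> S A; rewrite ltnNge -[X in (_ <= X)%N]card_ord max_card.
elim: n.+1 v => [|k IH] v vk vi bv av.
  exists (fun _ _ => 0) => [S A|S A]; first by rewrite eqxx.
  by rewrite vk // [LHS]big1 // => a _; rewrite !mulr0.
have [] := IH (fun S A => v S A - boundary (top_fill k v) S A).
- by move=> S A kS; rewrite (boundary_top_fill A vi bv av vk kS) subrr.
- have fi := chain_on_boundary (@top_fill_on _ k _ vi).
  move=> S A; apply: contraNT => SA.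
  by rewrite (chain_on0 vi) // (chain_on0 fi) // subrr.
- by move=> S A; rewrite boundaryB bv boundary_boundary subrr.
- rewrite /augment; under eq_bigr do rewrite mulrBl.
  by rewrite sumrB -/(augment v) -/(augment (boundary (top_fill k v)))
       augment_boundary av subrr.
move=> w wi bw; exists (fun S A => top_fill k v S A + w S A) => S A.
  apply: contraNT => SA.
  by rewrite (chain_on0 (@top_fill_on _ k _ vi)) // (chain_on0 wi) // addr0.
by rewrite boundaryD bw addrC subrK.
Qed.

End Exactness.

(** * The cubical resolution in coordinates *)

Section CubicalResolution.

Variables (K : fieldType) (n : nat) (D : {pred {set 'I_n}}).
Hypothesis D_down :
  forall S S' : {set 'I_n}, S \subset S' -> S' \in D -> S \in D.
Local Notation T := {mpoly K[n + n]}.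
Implicit Types (S A : {set 'I_n}) (a b : 'I_n) (i : nat).
Local Notation chain := ({set 'I_n} -> {set 'I_n} -> T).
Local Notation on := (@chain_on K n D).

Definition faces i : {set {set 'I_n} * {set 'I_n}} :=
  [set c : {set 'I_n} * {set 'I_n} |
     [&& c.1 \in D, c.2 \subset c.1 & #|c.2| == i]].

Definition face i (j : 'I_#|faces i|) := enum_val j.

Definition chain_of i (u : 'rV[T]_#|faces i|) : chain := fun S A =>
  \sum_(j | face j == (S, A)) u 0 j.

Definition row_of i (v : chain) : 'rV[T]_#|faces i| :=
  \row_j v (face j).1 (face j).2.

(** The sum has at most one term: [a] is the element of the second component
    of [face j] missing in that of [face k]. *)
Definition boundary_mx i : 'M[T]_(#|faces i.+1|, #|faces i|) :=
  \matrix_(j, k) \sum_(a | (a \notin (face k).2)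
                        && ((a |: (face k).1, a |: (face k).2) == face j))
     (-1) ^+ #|below (face k).2 a| * face_coef K (face k).1 a.

Definition augment_mx : 'cV[T]_#|faces 0| := \col_j set_monomial K (face j).1.

Lemma chain_of_on i u : on i (@chain_of i u).
Proof.
move=> S A; apply: contraNT => SA; rewrite /chain_of big_pred0 // => j.
apply: contraNF SA => /eqP jSA; have := enum_valP j.
by rewrite inE -/(face j) jSA.
Qed.

Arguments chain_of_on {i} u S A _.

Lemma chain_ofK i u : row_of i (chain_of u) = u.
Proof.
apply/rowP => j; rewrite mxE /chain_of (big_pred1 j) // => k.
by rewrite -surjective_pairing (inj_eq enum_val_inj).
Qed.

Lemma row_ofK i v : on i v -> chain_of (row_of i v) =2 v.
Proof.
move=> vi S A; have [cSA|cSA] := boolP ((S, A) \in faces i); last first.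
  have SA : ~~ [&& S \in D, A \subset S & #|A| == i] by move: cSA; rewrite inE.
  by rewrite (chain_on0 vi SA) (chain_on0 (chain_of_on _) SA).
rewrite /chain_of (big_pred1 (enum_rank_in cSA (S, A))) => [|j].
  by rewrite mxE /face enum_rankK_in.
by rewrite /= -(inj_eq enum_val_inj) enum_rankK_in.
Qed.

Lemma row_of_ext i v w : v =2 w -> row_of i v = row_of i w.
Proof. by move=> vw; apply/rowP => j; rewrite !mxE vw. Qed.

Lemma mul_boundary_mx i u :
  u *m boundary_mx i = row_of i (boundary (chain_of u)).
Proof.
apply/rowP => k; rewrite !mxE /boundary.
under eq_bigr do rewrite mxE mulr_sumr.
rewrite (exchange_big_dep (fun a => a \notin (face k).2)) /=; last first.
  by move=> j a _ /andP[].
apply: eq_bigr => a aA; rewrite /chain_of !mulr_sumr.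
apply: eq_big => [j|j _]; first by rewrite aA eq_sym.
by rewrite mulrC mulrA.
Qed.

Lemma mul_augment_mx u : u *m augment_mx = (augment (chain_of u))%:M.
Proof.
apply/matrixP => x y; rewrite !ord1 !mxE eqxx mulr1n /augment.
rewrite (partition_big (fun j => (face j).1) predT) //=.
apply: eq_bigr => S _; rewrite /chain_of mulr_suml.
apply: eq_big => [j|j /eqP <-].
  have := enum_valP j; rewrite inE -/(face j) => /and3P[_ _].
  rewrite cards_eq0 [face j in RHS]surjective_pairing xpair_eqE => ->.
  by rewrite andbT.
by rewrite mxE.
Qed.

Local Notation I := (gen_ideal D (@set_monomial K n)).

Lemma augment_mx_image (p : T) :
  p \in I <-> exists u : 'rV[T]_#|faces 0|, u *m augment_mx = p%:M.
Proof.
split=> [/asboolP[c pE]|[u uE]].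
  pose v : chain := fun S A => if (S \in D) && (A == set0) then c S else 0.
  have v0 : on 0 v.
    move=> S A; rewrite /v.
    case: ifP => [/andP[-> /eqP->] _|]; last by rewrite eqxx.
    by rewrite sub0set cards0 eqxx.
  exists (row_of 0 v); rewrite mul_augment_mx /augment; congr _%:M.
  rewrite pE [RHS]big_mkcond; apply: eq_bigr => S _.
  rewrite (row_ofK v0) /v eqxx andbT -[D S]/(S \in D).
  by case: ifP => _; rewrite ?mul0r.
apply/asboolP; exists (fun S => chain_of u S set0).
move: uE; rewrite mul_augment_mx => /matrixP/(_ 0 0).
rewrite !mxE eqxx !mulr1n => <-.
rewrite [RHS]big_mkcond; apply: eq_bigr => S _; case: ifPn => // DS.
by rewrite (chain_on0 (chain_of_on _)) ?mul0r // negb_and DS.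
Qed.

Lemma boundary_mx_eq0 i u :
  u *m boundary_mx i = 0 <-> forall S A, boundary (chain_of u) S A = 0.
Proof.
have bi := chain_on_boundary D_down (@chain_of_on i.+1 u).
rewrite mul_boundary_mx; split=> [u0 S A|b0]; last first.
  by apply/rowP => j; rewrite !mxE b0.
by rewrite -(row_ofK bi) u0 /chain_of big1 // => j _; rewrite mxE.
Qed.

Lemma boundary_mxK i (v : 'rV[T]_#|faces i.+2|) :
  v *m boundary_mx i.+1 *m boundary_mx i = 0.
Proof.
apply/boundary_mx_eq0 => S A.
rewrite mul_boundary_mx -[RHS](boundary_boundary (chain_of v) S A).
apply: eq_bigr => a _; rewrite row_ofK //.
exact: (chain_on_boundary D_down (@chain_of_on i.+2 v)).
Qed.

Lemma boundary_augment_mx (v : 'rV[T]_#|faces 1|) :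
  v *m boundary_mx 0 *m augment_mx = 0.
Proof.
rewrite mul_augment_mx mul_boundary_mx -scalemx1.
rewrite [augment _](_ : _ = 0) ?scale0r // -[RHS](augment_boundary (chain_of v)).
apply: eq_bigr => S _; rewrite row_ofK //.
exact: (chain_on_boundary D_down (@chain_of_on 1 v)).
Qed.

Lemma boundary_preimage i (u : 'rV[T]_#|faces i|) :
  (forall S A, boundary (chain_of u) S A = 0) -> augment (chain_of u) = 0 ->
  exists v, v *m boundary_mx i = u.
Proof.
move=> bu au; have [w wi bw] := chain_exact D_down (@chain_of_on i u) bu au.
exists (row_of i.+1 w); rewrite mul_boundary_mx -[RHS]chain_ofK.
apply: row_of_ext => S A; rewrite -bw; apply: eq_bigr => a _.
by rewrite row_ofK.
Qed.

Lemma boundary_mx_exact0 (u : 'rV[T]_#|faces 0|) :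
  u *m augment_mx = 0 <-> exists v, v *m boundary_mx 0 = u.
Proof.
split=> [uA|[v <-]]; last exact: boundary_augment_mx.
apply: boundary_preimage => [S A|].
  apply: big1 => a aA; rewrite (chain_on0 (chain_of_on _)) ?mulr0 //.
  by rewrite cardsU1 aA add1n !andbF.
by move: uA; rewrite mul_augment_mx => /matrixP/(_ 0 0);
  rewrite !mxE eqxx mulr1n.
Qed.

Lemma boundary_mx_exact i (u : 'rV[T]_#|faces i.+1|) :
  u *m boundary_mx i = 0 <-> exists v, v *m boundary_mx i.+1 = u.
Proof.
split=> [/boundary_mx_eq0 bu|[v <-]]; last exact: boundary_mxK.
apply: boundary_preimage => //; apply: big1 => S _.
by rewrite (chain_on0 (chain_of_on _)) ?mul0r // cards0 !andbF.
Qed.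

Lemma set_monomial_homog S : set_monomial K S \is n.-homog.
Proof.
have h (B : {set 'I_n}) (f : 'I_n -> 'I_(n + n)) :
    \prod_(r in B) ('X_(f r) : T) \is #|B|.-homog.
  rewrite -sum1_card; elim/big_rec2: _ => [|r d p _ pd]; first exact: dhomog1.
  by apply: dhomogM => //; rewrite dhomogX /= mdeg1.
by rewrite -[X in X.-homog](card_ord n) -(cardsC S); apply: dhomogM; apply: h.
Qed.

Lemma boundary_mx_homog i j k : boundary_mx i j k \is 1.-homog.
Proof.
rewrite mxE; apply: rpred_sum => a _; rewrite rpredMsign /face_coef.
by case: ifP => _; rewrite ?rpredN dhomogX /= mdeg1.
Qed.

Lemma homog_const d (p : T) : p \is d.+1.-homog -> p@_0%MM = 0.
Proof. by move=> pd; apply: (dhomog_nemf_coeff pd); rewrite /= mdeg0. Qed.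

(** The generator of a face of dimension [i] has degree [n + i]. *)
Definition cubical_resolution : graded_free_resolution I.
Proof.
refine (@GradedFreeResolution K _ I (fun i => #|faces i|)
  (fun i _ => (n + i)%:Z) augment_mx boundary_mx _ _ augment_mx_image
  boundary_mx_exact0 boundary_mx_exact).
  move=> j mon; rewrite mxE => /(dhomog_mf (set_monomial_homog _)) /= ->.
  by rewrite addn0.
move=> i j k mon /(dhomog_mf (boundary_mx_homog _ _)) /= ->.
rewrite !PoszD opprD addrACA subrr add0r -[i.+1]addn1 PoszD.
by rewrite addrAC subrr add0r.
Defined.

Lemma cubical_resolution_minimal : minimal_resolution cubical_resolution.
Proof. by move=> i j k; apply: (homog_const (boundary_mx_homog _ _)). Qed.

Lemma gen_ideal_const p : (0 < n)%N -> p \in I -> p@_0%MM = 0.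
Proof.
move=> n0 /asboolP[c ->]; rewrite raddf_sum big1 // => S _.
have g0 : (set_monomial K S)@_0%MM = 0.
  apply: (@homog_const n.-1); rewrite prednK //; exact: set_monomial_homog.
by rewrite [LHS](rmorphM (mcoeff 0%MM)) /= g0 mulr0.
Qed.

End CubicalResolution.

(** * Sparse sets on a path and on a cycle *)

Section CyclePower.

Local Open Scope nat_scope.

Variable n : nat.
Implicit Types (x y z : 'I_n) (i j k : nat).

Definition cyc_dist i j := minn ((i - j) + (j - i)) (n - ((i - j) + (j - i))).

Lemma cyc_dist_edge x y z :
  cycle_graph n x y -> cyc_dist x z <= (cyc_dist y z).+1.
Proof.
rewrite /cycle_graph /cyc_dist => /andP[_].
have := ltn_ord x; have := ltn_ord y; have := ltn_ord z.
move: (nat_of_ord x) (nat_of_ord y) (nat_of_ord z) => a b c; lia.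
Qed.

Lemma cyc_dist_path x p :
  path (cycle_graph n) x p -> cyc_dist x (last x p) <= size p.
Proof.
elim: p x => [|y p IH] x /=; first by rewrite /cyc_dist; lia.
by case/andP=> /cyc_dist_edge xy /IH yp; apply: leq_trans (xy _) _.
Qed.

(** One walks along the shorter of the two arcs. *)
Lemma cyc_dist_step x y k : cyc_dist x y = k.+1 ->
  exists2 z, cycle_graph n x z & cyc_dist z y = k.
Proof.
move=> xyk; have xn := ltn_ord x; have yn := ltn_ord y.
have [c [cn cx cy]] : exists c, [/\ c < n,
    (val x != c) && [|| c == x.+1, val x == c.+1,
        (val x == 0) && (c.+1 == n) | (c == 0) && (x.+1 == n)] &
    cyc_dist c y = k].
  move: xyk xn yn; rewrite /cyc_dist /=; move: (nat_of_ord x) (nat_of_ord y) => a b.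
  move=> abk an bn.
  have [ab|ab] := ltnP a b.
    have [s|s] := leqP (b - a) (n - (b - a)); first by exists a.+1; split; lia.
    by exists (if a == 0 then n.-1 else a.-1); case: ifP => a0; split; lia.
  have [s|s] := leqP (a - b) (n - (a - b)); first by exists a.-1; split; lia.
  by exists (if a.+1 == n then 0 else a.+1); case: ifP => a0; split; lia.
by exists (Ordinal cn).
Qed.

Lemma cyc_dist_walk k x y :
  cyc_dist x y = k -> has_walk (cycle_graph n) k x y.
Proof.
elim: k x => [|k IH] x.
  have := ltn_ord x; have := ltn_ord y; rewrite /cyc_dist => yn xn xy.
  apply/existsP; exists [tuple] => /=; rewrite -val_eqE /=.
  by move: xy xn yn; move: (nat_of_ord x) (nat_of_ord y) => a b; lia.
case/cyc_dist_step=> z xz /IH/existsP[p /andP[zp zy]].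
by apply/existsP; exists [tuple of z :: p]; rewrite /= xz zp.
Qed.

(** The length of a shortest walk is the distance around the cycle. *)
Lemma graph_power_cycle d x y :
  graph_power (cycle_graph n) d x y = (x != y) && (cyc_dist x y <= d).
Proof.
rewrite /graph_power; congr (_ && _); apply/existsP/idP => [[k /andP[]]|xyd].
  case/existsP=> p /andP[/cyc_dist_path xp /eqP <-] _.
  by rewrite (leq_trans xp) // size_tuple -ltnS.
have ex : exists k, has_walk (cycle_graph n) k x y.
  by exists (cyc_dist x y); apply: cyc_dist_walk.
case: (ex_minnP ex) => m wm mmin.
have md : m < d.+1 by rewrite ltnS (leq_trans _ xyd) // mmin // cyc_dist_walk.
exists (Ordinal md); rewrite /at_dist wm /=; apply/forallP => j.
by apply/negP => /mmin; rewrite leqNgt ltn_ord.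
Qed.

Lemma independent_cycle_power d (S : {set 'I_n}) :
  reflect {in S &, forall x y, x < y -> d < y - x /\ d < n - (y - x)}
          (independent (graph_power (cycle_graph n) d) S).
Proof.
apply: (iffP forall_inP) => [indS x y xS yS xy|sparse x xS].
  have := forall_inP (indS x xS) y yS; rewrite graph_power_cycle -val_eqE /=.
  have := ltn_ord y; move: xy; rewrite /cyc_dist.
  by move: (nat_of_ord x) (nat_of_ord y) => a b; lia.
apply/forall_inP => y yS; rewrite graph_power_cycle -val_eqE /=.
have := sparse x y xS yS; have := sparse y x yS xS; rewrite /cyc_dist.
by move: (nat_of_ord x) (nat_of_ord y) => a b; lia.
Qed.

End CyclePower.

Lemma independentS (T : finType) (e : rel T) (A B : {set T}) :
  A \subset B -> independent e B -> independent e A.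
Proof.
move=> /subsetP AB /forall_inP indB; apply/forall_inP => x xA.
by apply/forall_inP => y yA; apply: (forall_inP (indB x (AB x xA))); apply: AB.
Qed.

Section Counting.

Local Open Scope nat_scope.

Variables (n d : nat).
Implicit Types (S : {set 'I_n}) (x y : 'I_n) (lo hi k : nat).

(** Removing the vertex [x] is a bijection from [X] to [Y]. *)
Lemma card_setU1_bij (X Y : {set {set 'I_n}}) x :
  {in X, forall S, x \in S} -> {in Y, forall S, x \notin S} ->
  (forall S, x \notin S -> (x |: S \in X) = (S \in Y)) -> #|X| = #|Y|.
Proof.
move=> Xx Yx XY; have -> : X = (fun S => x |: S) @: Y.
  apply/setP => S; apply/idP/imsetP => [SX|[S' S'Y ->]]; last by rewrite XY ?Yx.
  exists (S :\ x); last by rewrite setD1K ?Xx.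
  by rewrite -XY ?setD11 // setD1K ?Xx.
apply: card_in_imset => S S' SY S'Y E.
by rewrite -(setU1K (Yx S SY)) E setU1K ?Yx.
Qed.

Definition sparse_in lo hi S :=
  [forall x in S, (lo <= x < hi) && [forall y in S, (x < y) ==> (d < y - x)]].

Lemma sparse_inP lo hi S :
  reflect ({in S, forall x, lo <= x < hi} /\
           {in S &, forall x y, x < y -> d < y - x})
          (sparse_in lo hi S).
Proof.
apply: (iffP forall_inP) => [sp|[rg sp] x xS].
  split=> [x /sp/andP[]//|x y /sp/andP[_ /forall_inP spx] /spx/implyP]; exact.
by rewrite rg //=; apply/forall_inP => y yS; apply/implyP; apply: sp.
Qed.

Definition sparse_sets lo hi k :=
  [set S : {set 'I_n} | sparse_in lo hi S & #|S| == k].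

Lemma card_sparse_sets0 lo hi : #|sparse_sets lo hi 0| = 1.
Proof.
rewrite -(cards1 (set0 : {set 'I_n})); apply: eq_card => S; rewrite !inE cards_eq0.
by rewrite andbC; case: eqP => //= ->; apply/sparse_inP; split=> x; rewrite inE.
Qed.

(** A sparse set either avoids [lo] or contains it and avoids the [d] vertices that
    follow. *)
Lemma card_sparse_setsS lo hi k : lo < hi -> hi <= n ->
  #|sparse_sets lo hi k.+1| =
    #|sparse_sets lo.+1 hi k.+1| + #|sparse_sets (lo + d.+1) hi k|.
Proof.
move=> lohi hin; pose x0 := Ordinal (leq_trans lohi hin).
rewrite -(cardsID [set S : {set 'I_n} | x0 \in S]) addnC; congr (_ + _).
  apply: eq_card => S; rewrite !inE andbA; congr (_ && _).
  apply/andP/sparse_inP => [[x0S /sparse_inP[rg sp]]|[rg sp]].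
    split=> // x xS; have /andP[lox ->] := rg x xS.
    rewrite andbT ltn_neqAle lox andbT; apply: contraNneq x0S => xlo.
    by rewrite (_ : x0 = x) //; apply: val_inj.
  split; first by apply/negP => /rg; rewrite /= ltnn.
  by apply/sparse_inP; split=> // x /rg /andP[/ltnW -> ->].
apply: (@card_setU1_bij _ _ x0) => [S|S|S x0S]; rewrite !inE.
- by case/andP.
- by move=> /andP[/sparse_inP[rg _] _]; apply/negP => /rg /=; lia.
rewrite eqxx andbT cardsU1 x0S add1n eqSS; congr (_ && _).
apply/sparse_inP/sparse_inP => -[rg sp].
  split=> [x xS|x y xS yS]; last by apply: sp; rewrite inE ?xS ?yS orbT.
  have xS' : x \in x0 |: S by rewrite inE xS orbT.
  have x0x : x0 != x by apply: contraNneq x0S => ->.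
  have := rg x xS'; have := sp x0 x (setU11 _ _) xS'; move: x0x.
  by rewrite -val_eqE /=; lia.
split=> [x|x y] /setU1P.
  by case=> [->|/rg] /=; lia.
move=> [->|xS] /setU1P[->|yS]; rewrite ?ltnn //=.
- by have := rg y yS; lia.
- by have := rg x xS; lia.
exact: sp.
Qed.

(** With [m = hi - lo] this is [binomial(m - d (k - 1), k)]; the form
    [m + d - d * k] is also right for [k = 0], and when the subtraction is truncated
    both sides are zero. *)
Lemma card_sparse_sets lo hi k : hi <= n ->
  #|sparse_sets lo hi k| = 'C(hi - lo + d - d * k, k).
Proof.
move=> hin; have [m hm] : {m | hi - lo <= m} by exists (hi - lo).
elim: m lo k hm => [|m IH] lo [|k] hm; rewrite ?card_sparse_sets0 ?bin0 //.
- rewrite bin_small; last by nia.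
  apply/eqP; rewrite cards_eq0 -subset0; apply/subsetP => S; rewrite !inE.
  case/andP=> /sparse_inP[rg _] /eqP Sk.
  have /card_gt0P[x /rg] : #|S| > 0 by rewrite Sk.
  by lia.
have [lohi|hilo] := ltnP lo hi; last by rewrite IH //; lia.
rewrite card_sparse_setsS // !IH; [|lia|lia].
(* For [hi - lo.+1 < d * k] all three numbers vanish; else this is Pascal's rule. *)
have [s|s] := ltnP (hi - lo.+1) (d * k).
  have k0 : 0 < k by case: (k) s => //; rewrite muln0.
  have dk := leq_pmulr d k0.
  by rewrite !bin_small // ?mulnS; lia.
have -> : hi - lo + d - d * k.+1 = (hi - lo.+1 - d * k).+1.
  by rewrite mulnS; move: (d * k) s => e s; lia.
rewrite binS; congr ('C(_, _) + _); first by rewrite mulnS; lia.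
have [hd|hd] := leqP d (hi - lo.+1); first by congr 'C(_, _); nia.
by case: k s => [|k] s; [rewrite !bin0 | rewrite !bin_small //; nia].
Qed.

Definition indep_sets k :=
  [set S : {set 'I_n} | independent (graph_power (cycle_graph n) d) S & #|S| == k].

(** The first summand counts the sets avoiding [0, ..., d]: for them no further
    condition comes from going round the cycle.  Otherwise the set contains exactly
    one [x <= d], and the others lie between [x + d + 1] and [n - d - 1 + x]. *)
Lemma card_indep_setsS k : d < n -> 0 < d ->
  #|indep_sets k.+1| = 'C(n - d.+1 + d - d * k.+1, k.+1)
     + d.+1 * 'C(n - (2 * d).+1 + d - d * k, k).
Proof.
move=> dn d0.
rewrite -(cardsID [set S : {set 'I_n} | [exists x in S, x <= d]]) addnC.
congr (_ + _).
  rewrite -card_sparse_sets //; apply: eq_card => S; rewrite !inE andbA.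
  congr (_ && _).
  apply/andP/sparse_inP => [[/exists_inPn Sd /independent_cycle_power sp]|[rg sp]].
    split=> [x xS|x y xS yS xy]; last by case: (sp x y xS yS xy).
    by rewrite ltn_ord andbT ltnNge Sd.
  split; first by apply/exists_inPn => x /rg; lia.
  apply/independent_cycle_power => x y xS yS xy.
  have := sp x y xS yS xy; have := rg x xS; have := rg y yS; lia.
rewrite -sum1_card.
(* The inner sum is 0 or 1, since two vertices below [d.+1] are too close. *)
transitivity (\sum_(S in indep_sets k.+1) \sum_(x in S | x <= d) 1).
  rewrite [RHS](bigID (fun S : {set 'I_n} => [exists x in S, x <= d])) /=.
  rewrite [X in _ + X]big1 ?addn0 => [|S /andP[_ /exists_inPn Sd]]; last first.
    by rewrite big_pred0 // => x; apply/negP => /andP[/Sd/negP].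
  apply: eq_big => [S|S]; first by rewrite !inE.
  rewrite !inE => /andP[/andP[/independent_cycle_power sp _] /exists_inP[x xS xd]].
  rewrite (big_pred1 x) // => y; apply/andP/eqP => [[yS yd]|->//].
  have [xy|yx|/val_inj//] := ltngtP x y; exfalso.
    have [dxy _] := sp x y xS yS xy.
    by have := leq_trans dxy (leq_subr _ _); rewrite ltnNge yd.
  have [dyx _] := sp y x yS xS yx.
  by have := leq_trans dyx (leq_subr _ _); rewrite ltnNge xd.
rewrite (exchange_big_dep (fun x : 'I_n => x <= d)) /= => [|S x _ /andP[]//].
transitivity (\sum_(x : 'I_n | x <= d) 'C(n - (2 * d).+1 + d - d * k, k)).
  apply: eq_bigr => x xd; rewrite sum1_card.
  (* The length of the remaining interval does not depend on [x]. *)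
  have -> : n - (2 * d).+1 = (n - d + x) - (x + d.+1) by lia.
  rewrite -card_sparse_sets; last by lia.
  transitivity #|[set S in indep_sets k.+1 | x \in S]|.
    by apply: eq_card => S; rewrite !inE /= -topredE /= !inE xd andbT.
  apply: (@card_setU1_bij _ _ x) => [S|S|S xS]; rewrite !inE.
  - by case/andP.
  - by move=> /andP[/sparse_inP[rg _] _]; apply/negP => /rg; lia.
  rewrite eqxx !andbT cardsU1 xS add1n eqSS; congr (_ && _).
  apply/independent_cycle_power/sparse_inP => [sp|[rg sp] y z].
    split=> [y yS|y z yS zS yz]; last first.
      by case: (sp y z _ _ yz) => //; rewrite inE ?yS ?zS orbT.
    have yS' : y \in x |: S by rewrite inE yS orbT.
    have xy : x != y by apply: contraNneq xS => ->.
    have := sp x y (setU11 _ _) yS'; have := sp y x yS' (setU11 _ _).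
    have := ltn_ord y; move: xy; rewrite -val_eqE /=; lia.
  move=> /setU1P[->|yS] /setU1P[->|zS]; rewrite ?ltnn //.
  - by have := rg z zS; lia.
  - by have := rg y yS; lia.
  by move=> yz; have := sp y z yS zS yz; have := rg y yS; have := rg z zS; lia.
rewrite -(big_ord_widen n (fun=> 'C(n - (2 * d).+1 + d - d * k, k)) dn).
by rewrite sum_nat_const card_ord.
Qed.

End Counting.

(** * The number of faces *)

Section CycleCount.

Local Open Scope nat_scope.

Variables (n d : nat).
Hypotheses (dn : d < n) (d0 : 0 < d).

Lemma card_indep_sets0 : #|indep_sets n d 0| = 1.
Proof.
rewrite -(cards1 (set0 : {set 'I_n})); apply: eq_card => S; rewrite !inE cards_eq0.
rewrite andbC; case: eqP => //= ->.
by apply/independent_cycle_power => x y; rewrite inE.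
Qed.

(** With [m = n - d k] and [k > 0] the two counts of [card_indep_setsS] are
    [binomial(m-1, k) + (d+1) binomial(m-1, k-1)], that is, by Pascal's rule,
    [binomial(m, k) + d binomial(m-1, k-1)]; and
    [m binomial(m-1, k-1) = k binomial(m, k)].  The division by [m] is avoided in
    order to stay within the natural numbers. *)
Lemma mul_card_indep_sets k : k * d.+1 <= n ->
  (n - d * k) * #|indep_sets n d k| = n * 'C(n - d * k, k).
Proof.
case: k => [|k] kn; first by rewrite card_indep_sets0 bin0 muln0 subn0.
have kd : d * k.+1 + k.+1 <= n by rewrite [d * _]mulnC -mulnSr.
have [m nE] : {m | n = (d * k.+1 + m.+1)%N}.
  by exists (n - d * k.+1).-1; lia.
rewrite card_indep_setsS // mulnS.
have -> : n - d.+1 + d - (d + d * k) = m by rewrite nE mulnS; lia.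
have -> : n - (d + d * k) = m.+1 by rewrite nE mulnS; lia.
have -> : 'C(n - (2 * d).+1 + d - d * k, k) = 'C(m, k).
  case: k nE {kn} kd => [|k] nE kd; rewrite ?bin0 //; congr 'C(_, _).
  by rewrite nE !mulnS; lia.
have := mul_bin_diag m.+1 k; rewrite /= binS.
move: 'C(m, k.+1) 'C(m, k) => b c E.
by rewrite [X in _ = X * _]nE mulnDl -mulnA -E; ring.
Qed.

Lemma card_indep_sets_eq0 k : n < k * d.+1 -> #|indep_sets n d k| = 0.
Proof.
case: k => // k kn; rewrite card_indep_setsS //.
have kd : n < d * k + k + d.+1 by move: kn; rewrite mulSn mulnS (mulnC k); lia.
case: k kd {kn} => [|k] kd; first by move: kd; rewrite muln0; lia.
by rewrite !bin_small ?muln0 // !mulnS; move: kd; rewrite !mulnS; lia.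
Qed.

Lemma card_indep_sets_gt0 k : k * d.+1 <= n -> 0 < #|indep_sets n d k|.
Proof.
move=> kn; have := mul_card_indep_sets kn.
have kd : k <= n - d * k by move: kn; rewrite mulnS (mulnC k); lia.
have : 0 < 'C(n - d * k, k) by rewrite bin_gt0.
by case: #|_| => // C0; rewrite muln0; nia.
Qed.

End CycleCount.

Section FaceCount.

Local Open Scope nat_scope.

Variables (n : nat) (D : {pred {set 'I_n}}).

Lemma card_faces i : #|faces D i| = \sum_(S in D) 'C(#|S|, i).
Proof.
rewrite -sum1_card (partition_big (fun c => c.1) (mem D)) /=; last first.
  by move=> c; rewrite inE => /andP[].
apply: eq_bigr => S DS; rewrite -cards_draws -sum1_card.
rewrite (reindex_onto (fun A => (S, A)) (fun c => c.2)) /=; last first.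
  by move=> [S' A] /andP[_ /eqP /= ->].
by apply: eq_bigl => A; rewrite !inE /= DS !eqxx !andbT.
Qed.

Lemma card_faces_by_size i q : q <= n ->
  (forall k, q < k -> #|[set S in D | #|S| == k]| = 0) ->
  #|faces D i| = \sum_(0 <= k < q.+1) #|[set S in D | #|S| == k]| * 'C(k, i).
Proof.
move=> qn large; rewrite card_faces big_mkord.
rewrite (big_ord_widen n.+1 (fun k => #|[set S in D | #|S| == k]| * 'C(k, i))) //.
rewrite [RHS]big_mkcond /=.
have size_ord (S : {set 'I_n}) : #|S| < n.+1.
  by rewrite ltnS -[X in _ <= X]card_ord max_card.
rewrite (partition_big (fun S => Ordinal (size_ord S)) predT) //=.
apply: eq_bigr => k _.
transitivity (\sum_(S in [set S in D | #|S| == k]) 'C(k, i)).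
  by apply: eq_big => [S|S /andP[_ /eqP <-]//]; rewrite inE -val_eqE.
by rewrite sum_nat_const; case: ltnP => // /large ->.
Qed.

End FaceCount.

(** * Betti numbers and projective dimension *)

(* [n - d * k] is truncated, but [d * k < n] for all [k <= n %/ d.+1]. *)
Theorem proposition3p4 (K : fieldType) (d n : nat)
    (hd : (1 <= d)%N) (hn : (d + 1 <= n)%N) :
  let I := indep_ideal K (graph_power (cycle_graph n) d) in
  (forall i : nat, exists2 b : nat, total_betti I i b &
     b%:R = \sum_(0 <= k < (n %/ (d + 1)).+1)
              n%:R / (n - d * k)%:R * 'C(n - d * k, k)%:R * 'C(k, i)%:R :> rat)
  /\ proj_dim_eq (quotmod I) (n %/ (d + 1) + 1).
Proof.
move=> I; set q := (n %/ (d + 1))%N.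
have dn : (d < n)%N by rewrite -addn1.
have n0 : (0 < n)%N by apply: leq_ltn_trans dn.
pose e := graph_power (cycle_graph n) d.
have down (S S' : {set 'I_n}) :
    S \subset S' -> S' \in (independent e : {pred _}) ->
    S \in (independent e : {pred _}) by apply: independentS.
pose F : graded_free_resolution I := cubical_resolution K down.
have Fmin : minimal_resolution F := @cubical_resolution_minimal K n _ down.
have I0 (p : {mpoly K[n + n]}) : p \in I -> p@_0%MM = 0 := gen_ideal_const n0.
have kq k : (k <= q)%N = (k * d.+1 <= n)%N by rewrite /q addn1 leq_divRL.
have size_sets k :
    [set S in (independent e : {pred _}) | #|S| == k] = indep_sets n d k.
  by apply/setP => S; rewrite !inE.
have rankE i :
    fr_rank F i = (\sum_(0 <= k < q.+1) #|indep_sets n d k| * 'C(k, i))%N.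
  apply: card_faces_by_size => [|k]; first exact: leq_div.
  rewrite size_sets ltnNge kq -ltnNge; exact: card_indep_sets_eq0.
split=> [i|].
  exists (fr_rank F i); first exact: minimal_total_betti.
  rewrite rankE natr_sum; apply: eq_big_nat => k; rewrite ltnS => /andP[_].
  rewrite kq natrM => kn; congr (_ * _).
  have nk0 : (n - d * k)%:R != 0 :> rat.
    rewrite Num.Theory.pnatr_eq0 subn_eq0 -ltnNge; move: kn; rewrite mulnS mulnC.
    by case: (k) => [|k']; lia.
  rewrite mulrAC -natrM -(mul_card_indep_sets dn hd kn) natrM.
  by rewrite mulrAC mulfV // mul1r.
rewrite addn1; apply: (minimal_proj_dim I0 Fmin).
  rewrite rankE big_nat_recr //= binn muln1 ltn_addl //.
  by apply: card_indep_sets_gt0; rewrite -?kq.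
move=> i qi; rewrite rankE big_nat big1 // => k /andP[_ kq1].
by rewrite bin_small ?muln0 //; apply: leq_trans kq1 _.
Qed.
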